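(* Let $q$ be a prime power. Every pencil of plane curves $\mathcal{L}=\langle F,G\rangle$ over $\mathbb{F}_q$ with no $\mathbb{F}_q$-points in its base locus has at least $\sqrt{q}$ many $\mathbb{F}_q$-members that are nonblocking.
   Context: A pencil of plane curves $\mathcal{L}=\langle F,G\rangle$ over $\mathbb{F}_q$ is given by two linearly independent homogeneous polynomials $F,G\in\mathbb{F}_q[x,y,z]$ of the same degree $d\ge 1$. Its $\mathbb{F}_q$-members are the $q+1$ plane curves $C_{[s:t]}=\{sF+tG=0\}\subset\mathbb{P}^2$ for $[s:t]\in\mathbb{P}^1(\mathbb{F}_q)$; members are counted by their parameters $[s:t]$. The pencil has no $\mathbb{F}_q$-points in its base locus if there is no $P\in\mathbb{P}^2(\mathbb{F}_q)$ with $F(P)=G(P)=0$. A set $B\subseteq\mathbb{P}^2(\mathbb{F}_q)$ is a blocking set if every $\mathbb{F}_q$-line (line in $\mathbb{P}^2$ defined over $\mathbb{F}_q$) meets $B$, i.e. contains a point of $B$. A plane curve $C$ defined over $\mathbb{F}_q$ is a blocking curve if its set $C(\mathbb{F}_q)$ of $\mathbb{F}_q$-points is a blocking set, and is nonblocking otherwise. *)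

(* Defs.v *)
From HB Require Import structures.
From mathcomp Require Export all_boot all_order all_algebra.
From mathcomp Require Export mpoly.
Set Implicit Arguments.
Unset Strict Implicit.
Unset Printing Implicit Defensive.
Import GRing.Theory.
Local Open Scope ring_scope.

Definition proportional (K : finFieldType) (m : nat) : rel 'rV[K]_m :=
  [rel u v | [exists c : K, (c != 0) && (v == c *: u)]].

(* A point of P^n(K) is the class of its (nonzero) coordinate vectors, so that *)
(* [v \in val P] says that v is a vector of homogeneous coordinates of P.      *)
Definition pspace (K : finFieldType) (n : nat) : finType :=
  {P : {set 'rV[K]_n.+1} |
     P \in equivalence_partition (@proportional K n.+1) [set v | v != 0]}.

(* A plane curve is given by a form f. For f homogeneous, the vanishing of f   *)
(* does not depend on the choice of coordinates, so quantifying over all of    *)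
(* them is harmless.                                                           *)
Definition curve_points (K : finFieldType) (f : {mpoly K[3]}) :
    {set pspace K 2} :=
  [set P : pspace K 2 | [forall v in val P, f.@[v 0] == 0]].

Definition line_points (K : finFieldType) (l : 'rV[K]_3) : {set pspace K 2} :=
  [set P : pspace K 2 | [forall v in val P, \sum_(i < 3) l 0 i * v 0 i == 0]].

Definition blocking_set (K : finFieldType) (B : {set pspace K 2}) : bool :=
  [forall (l : 'rV[K]_3 | l != 0), [exists P in B, P \in line_points l]].

Definition blocking_curve (K : finFieldType) (f : {mpoly K[3]}) : bool :=
  blocking_set (curve_points f).

Definition is_pencil (K : finFieldType) (d : nat) (F G : {mpoly K[3]}) : Prop :=
  [/\ (1 <= d)%N, F \is d.-homog, G \is d.-homog
    & forall a b : K, a *: F + b *: G = 0 -> a = 0 /\ b = 0].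

Definition pencil_member (K : finFieldType) (F G : {mpoly K[3]})
    (st : 'rV[K]_2) : {mpoly K[3]} :=
  st 0 0 *: F + st 0 1 *: G.

(* Rescaling [s:t] rescales sF + tG by a nonzero constant, hence does not      *)
(* change the curve.                                                           *)
Definition nonblocking_members (K : finFieldType) (F G : {mpoly K[3]}) :
    {set pspace K 1} :=
  [set T : pspace K 1 |
     [forall st in val T, ~~ blocking_curve (pencil_member F G st)]].

Definition no_rational_base_point (K : finFieldType) (F G : {mpoly K[3]}) :
    Prop :=
  ~ exists P : pspace K 2, P \in curve_points F /\ P \in curve_points G.

(* Main.v *)
(** Distinct members of the pencil have no rational point in common, so the
    q+1 members share out the q^2+q+1 points of the plane.  If two of them are
    blocking then no blocking member contains a line, since that line would
    miss the other one; by Bruen's bound each blocking member then has at least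
    q + sqrt q + 1 points.  As q^2+q+1 = (q + sqrt q + 1) (q - sqrt q + 1), at
    most q + 1 - sqrt q members are blocking.

    Bruen's bound for a blocking set B without lines: every line l satisfies
    1 <= |B /\ l| <= |B| - q, the upper bound by looking at the lines through a
    point of l off B.  Double counting in
    sum_l (|B /\ l| - 1) (|B| - q - |B /\ l|) >= 0 yields
    (|B| - q - 1)^2 >= q. *)
Require Import Defs.
From mathcomp Require Import mxabelem ring lra zify.
Set Implicit Arguments.
Unset Strict Implicit.
Unset Printing Implicit Defensive.
Import Order.TTheory GRing.Theory Num.Theory.
Local Open Scope ring_scope.

(** * Proportional and orthogonal vectors over a finite field *)

Section Vectors.
Variables (K : finFieldType) (n : nat).
Implicit Types (u v w l : 'rV[K]_n) (S : {set 'rV[K]_n}).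

Definition dot u v := \sum_i u 0 i * v 0 i.

Lemma dotC u v : dot u v = dot v u.
Proof. by apply: eq_bigr => i _; rewrite mulrC. Qed.

Lemma dotZl c u v : dot (c *: u) v = c * dot u v.
Proof. by rewrite mulr_sumr; apply: eq_bigr => i _; rewrite mxE mulrA. Qed.

Lemma mulmx_tr_eq0 u v : (v *m u^T == 0) = (dot u v == 0).
Proof.
apply/eqP/eqP => [/matrixP/(_ 0 0)|uv0]; last first.
  apply/matrixP => i j; rewrite !ord1 mxE mxE -[RHS]uv0 /dot.
  by apply: eq_bigr => k _; rewrite mxE mulrC.
rewrite mxE mxE => <-; apply: eq_bigr => k _.
by rewrite mxE mulrC.
Qed.

Lemma proportionalP u v :
  reflect (exists2 c, c != 0 & v = c *: u) (proportional u v).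
Proof.
apply: (iffP existsP) => -[c]; first by case/andP=> c0 /eqP->; exists c.
by move=> c0 ->; exists c; rewrite c0 eqxx.
Qed.

Lemma proportional_refl u : proportional u u.
Proof. by apply/proportionalP; exists 1; rewrite ?oner_eq0 ?scale1r. Qed.

Lemma proportional_neq0 u v : proportional u v -> u != 0 -> v != 0.
Proof. by case/proportionalP=> c c0 ->; rewrite scaler_eq0 negb_or c0. Qed.

Lemma proportional_sym u v : proportional u v -> proportional v u.
Proof.
case/proportionalP=> c c0 ->; apply/proportionalP; exists c^-1.
  by rewrite invr_eq0.
by rewrite scalerA mulVf ?scale1r.
Qed.

Lemma proportional_dot u v w : proportional u v ->
  (dot v w == 0) = (dot u w == 0).
Proof. by case/proportionalP=> c c0 ->; rewrite dotZl mulf_eq0 (negPf c0). Qed.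

Lemma card_proportional u : u != 0 -> #|[set v | proportional u v]| = #|K|.-1.
Proof.
move=> u0.
rewrite -(cardC1 (0 : K)) -(@card_in_imset _ _ (fun c : K => c *: u)).
  congr #|pred_of_set _|; apply/setP => v; rewrite inE.
  apply/proportionalP/imsetP => -[c]; first by move=> ? ->; exists c.
  by move=> ? ->; exists c.
move=> a b _ _ /eqP; rewrite -subr_eq0 -scalerBl scaler_eq0 (negPf u0) orbF.
by rewrite subr_eq0 => /eqP.
Qed.

Lemma card_rV_neq0 : #|[set v : 'rV[K]_n | v != 0]| = (#|K| ^ n - 1)%N.
Proof.
have -> : [set v : 'rV[K]_n | v != 0] = setT :\ 0.
  by apply/setP => v; rewrite !inE andbT.
have := cardsD1 (0 : 'rV[K]_n) setT.
by rewrite inE cardsT card_mx mul1n => ->; rewrite addKn.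
Qed.

(** The solutions form the kernel of a matrix of rank 1 or 2, from which the zero vector is removed.
    For [n = 3] this counts lines through two points, for [n = 2] members through a point; taking
    [u = v] handles a single condition. *)
Lemma card_orthogonal2 u v : u != 0 -> v != 0 ->
  #|[set l | [&& l != 0, dot l u == 0 & dot l v == 0]]|
  = (#|K| ^ (n - (if proportional u v then 1 else 2)) - 1)%N.
Proof.
move=> u0 v0; pose A := kermx (u + v)%MS^T.
have memA l : (l \in rowg A) = (dot l u == 0) && (dot l v == 0).
  rewrite mem_rowg sub_kermx -trmx_eq0 trmx_mul trmxK.
  rewrite -!mulmx_tr_eq0 -!sub_kermx; exact: addsmx_sub.
have -> : [set l | [&& l != 0, dot l u == 0 & dot l v == 0]] = rowg A :\ 0.
  by apply/setP => l; rewrite in_setD1 memA inE.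
have := cardsD1 0 (rowg A).
rewrite mem_rowg sub0mx card_rowg => /(congr1 predn) /=.
rewrite add0n => <-; rewrite -subn1 mxrank_ker mxrank_tr.
congr (_ ^ (_ - _) - _)%N.
case: ifP => [/proportionalP[c c0 ->]|nuv].
  by rewrite (addsmx_idPl (scalemx_sub c (submx_refl u))) rank_rV u0.
apply/eqP; rewrite eqn_leq; apply/andP; split.
  by apply: leq_trans (mxrank_adds_leqif _ _) _; rewrite !rank_rV u0 v0.
(* At rank 1 the line spanned by [u] would be the whole sum and contain [v]. *)
rewrite ltnNge; apply/negP => le1.
have : (u == u + v)%MS.
  rewrite -(geq_leqif (mxrank_leqif_eq (addsmxSl u v))).
  by rewrite rank_rV u0.
case/andP=> _; rewrite addsmx_sub submx_refl => /sub_rVP[c vE].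
case/negP: (negbT nuv); apply/proportionalP; exists c => //.
by apply: contraNneq v0 => c0; rewrite vE c0 scale0r.
Qed.

End Vectors.

(** * Bruen's bound, stated for cones in the space of coordinate vectors *)

Section BlockingSize.
Variables (K : finFieldType).
Implicit Types (v w l p : 'rV[K]_3) (S : {set 'rV[K]_3}).
Local Notation q := #|K|.

(* A set of points is represented by the cone of all its coordinate vectors, *)
(* so that cardinals of points and of lines get multiplied by q - 1.         *)
Definition cone S :=
  (0 \notin S) /\ (forall v w, v \in S -> proportional v w -> w \in S).

Definition blocking_cone S :=
  forall l, l != 0 -> exists2 v, v \in S & dot l v == 0.

Definition section S l := [set v in S | dot l v == 0].

Lemma cone_neq0 S v : cone S -> v \in S -> v != 0.
Proof. by case=> S0 _; apply: contraTneq => ->. Qed.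

Lemma section_proportional S l m :
  proportional l m -> section S m = section S l.
Proof.
by move=> lm; apply/setP => v; rewrite !inE (proportional_dot _ lm).
Qed.

(** One point of [S] on [l] brings along all its [q - 1] coordinate vectors. *)
Lemma section_ge S l :
  cone S -> blocking_cone S -> l != 0 -> (q.-1 <= #|section S l|)%N.
Proof.
move=> cS bS l0; have [v vS lv] := bS l l0.
rewrite -(card_proportional (cone_neq0 cS vS)).
apply/subset_leq_card/subsetP => w.
rewrite !inE => vw; rewrite (cS.2 _ _ vS vw) /= dotC.
by rewrite (proportional_dot _ vw) dotC.
Qed.

(** Double counting of incident pairs. [H] will be the lines through a point in [section_le], and
    all lines in [blocking_cone_card]. *)
Lemma sum_section S (H : {set 'rV[K]_3}) :
  (\sum_(l in H) #|section S l|
   = \sum_(v in S) #|[set l in H | dot l v == 0%R]|)%N.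
Proof.
have cardE (T : finType) (A : {set T}) (P : pred T) :
    #|[set x in A | P x]| = (\sum_(x in A) P x)%N.
  by rewrite -sum1dep_card big_mkcondr; apply: eq_bigr => x _; case: (P x).
under eq_bigr do rewrite cardE.
by rewrite exchange_big /=; apply: eq_bigr => v _; rewrite cardE.
Qed.

(* The other lines through a point [p] off [S] each need a point of [S]. *)
Lemma section_le S l p : cone S -> blocking_cone S -> l != 0 ->
  p != 0 -> p \notin S -> dot l p == 0 ->
  (#|section S l| + q * q.-1 <= #|S|)%N.
Proof.
move=> cS bS l0 p0 pS lp; have q1 : (1 < #|K|)%N := card_finNzRing_gt1 K.
pose H := [set m | [&& m != 0, dot m p == 0 & dot m p == 0]].
have cardH : #|H| = (q ^ 2 - 1)%N.
  by rewrite card_orthogonal2 // proportional_refl.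
have sumH : (\sum_(m in H) #|section S m| = #|S| * q.-1)%N.
  rewrite sum_section -sum_nat_const; apply: eq_bigr => v vS.
  have -> : [set m in H | dot m v == 0]
      = [set m | [&& m != 0, dot m p == 0 & dot m v == 0]].
    by apply/setP => m; rewrite !inE andbb -!andbA.
  rewrite card_orthogonal2 //; last exact: cone_neq0 vS.
  (* As [p] lies off the cone [S], [v] and [p] are distinct points, joined by exactly one line. *)
  rewrite ifN ?expn1 ?subn1 //; apply: contra pS => /proportional_sym.
  exact: cS.2.
have sLH : [set m | proportional l m] \subset H.
  apply/subsetP => m; rewrite !inE => lm.
  by rewrite (proportional_neq0 lm) // (proportional_dot _ lm) lp.
have cardL := card_proportional l0.
(* Among the [q ^ 2 - 1] vectors of [H], the [q - 1] multiples of [l] have the section of [l]; each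
   other one has a section of size at least [q - 1]. *)
have sum_ge : (q.-1 * #|section S l| + (q ^ 2 - 1 - q.-1) * q.-1
    <= #|S| * q.-1)%N.
  rewrite -sumH (big_setID [set m | proportional l m]) /= (setIidPr sLH).
  rewrite leq_add //.
    rewrite -{1}cardL -sum_nat_const leq_eqVlt; apply/orP; left; apply/eqP.
    by apply: eq_bigr => m; rewrite inE => /(section_proportional S) ->.
  rewrite -{1}cardL -cardH -(cardsDS sLH) -sum_nat_const; apply: leq_sum => m.
  by rewrite !inE => /andP[_ /andP[m0 _]]; apply: section_ge.
rewrite -(leq_pmul2r (_ : 0 < q.-1)%N); last by lia.
apply: leq_trans sum_ge; rewrite mulnDl (mulnC #|_|) leq_add2l.
by rewrite leq_mul2r; apply/orP; right; move: q1; case: q => [|a] //=; nia.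
Qed.

(** Count triples [(l, v, w)] with [v] and [w] in [S] on [l]. Given [v], each of the [q - 1] vectors
    [w] proportional to [v] leaves [q ^ 2 - 1] choices of [l], and every other [w] leaves
    [q - 1]. *)
Lemma sum_section_sqr S : cone S ->
  (\sum_(l : 'rV[K]_3 | l != 0%R) #|section S l| ^ 2
   = #|S| * (q.-1 * (q ^ 2 - 1) + (#|S| - q.-1) * q.-1))%N.
Proof.
move=> cS.
transitivity (\sum_(v in S) \sum_(w in S)
    #|[set l : 'rV[K]_3 | [&& l != 0, dot l v == 0 & dot l w == 0]%R]|)%N.
  have -> : (\sum_(l : 'rV[K]_3 | l != 0%R) #|section S l| ^ 2 =
     \sum_(l in [set l : 'rV[K]_3 | l != 0%R])
       \sum_(v in S) \sum_(w in S) ((dot l v == 0) && (dot l w == 0))%R)%N.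
    apply: eq_big => [l|l _]; first by rewrite inE.
    rewrite -mulnn -{1}sum1dep_card big_mkcondr big_distrl.
    apply: eq_bigr => v _ /=.
    rewrite -sum1dep_card big_mkcondr big_distrr; apply: eq_bigr => w _ /=.
    by do 2!case: eqP.
  rewrite exchange_big; apply: eq_bigr => v _ /=.
  rewrite exchange_big; apply: eq_bigr => w _ /=.
  rewrite -sum1dep_card big_mkcondr /=.
  apply: eq_big => [l|l _]; first by rewrite inE.
  by case: ifP.
rewrite -sum_nat_const; apply: eq_bigr => v vS.
have v0 := cone_neq0 cS vS.
have sPS : [set w | proportional v w] \subset S.
  by apply/subsetP => w; rewrite inE; apply: cS.2.
rewrite (big_setID [set w | proportional v w]) /= (setIidPr sPS); congr addn.
  rewrite -{1}(card_proportional v0) -sum_nat_const; apply: eq_bigr => w.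
  rewrite inE => vw; rewrite card_orthogonal2 ?vw //.
  exact: proportional_neq0 v0.
rewrite -(card_proportional v0) -(cardsDS sPS) -sum_nat_const.
apply: eq_bigr => w; rewrite !inE => /andP[/negPf nvw wS].
rewrite card_orthogonal2 ?nvw ?(cone_neq0 cS) //.
by rewrite card_proportional // expn1 subn1.
Qed.

(* Summing (x_l - (q - 1)) (|S| - q (q - 1) - x_l) >= 0 over all l <> 0,  *)
(* where x_l = |section S l|.                                            *)
Lemma blocking_cone_card (R : rcfType) S : cone S -> blocking_cone S ->
  (forall l, l != 0 -> exists p, [/\ p != 0, p \notin S & dot l p == 0]) ->
  (q%:R - 1) * (q%:R + Num.sqrt q%:R + 1) <= #|S|%:R :> R.
Proof.
move=> cS bS offS; have q1 : (1 < #|K|)%N := card_finNzRing_gt1 K.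
set Q : R := q%:R; set s : R := #|S|%:R; set r := Num.sqrt Q.
have Q0 : 0 <= Q by apply: ler0n.
have r0 : 0 <= r by apply: sqrtr_ge0.
have rr : r * r = Q by rewrite -expr2 sqr_sqrtr.
have Q1 : 1 < Q by rewrite ltr1n.
have qp : q.-1%:R = Q - 1 :> R by rewrite -subn1 natrB // ltnW.
have qX n : (q ^ n - 1)%N%:R = Q ^+ n - 1 :> R.
  by rewrite natrB ?natrX // expn_gt0 ltnW.
pose x l : R := #|section S l|%:R.
have x_ge l : l != 0 -> Q - 1 <= x l.
  by move=> l0; rewrite -qp ler_nat; apply: section_ge.
have x_le l : l != 0 -> x l + Q * (Q - 1) <= s.
  move=> l0; have [p [p0 pS lp]] := offS l l0.
  by rewrite -qp -natrM -natrD ler_nat; apply: section_le lp.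
have sumx : \sum_(l | l != 0) x l = s * (Q ^+ 2 - 1).
  rewrite -qX -natrM -natr_sum; congr (_%:R).
  have := sum_section S [set l | l != 0].
  rewrite (eq_bigl (fun l => l != 0)) => [->|l]; last by rewrite inE.
  rewrite -sum_nat_const; apply: eq_bigr => v vS.
  have v0 := cone_neq0 cS vS; have := card_orthogonal2 v0 v0.
  rewrite proportional_refl => <-; apply: eq_card => l.
  by rewrite !inE andbb.
have sumx2 : \sum_(l | l != 0) x l ^+ 2
    = s * ((Q - 1) * (Q ^+ 2 - 1) + (s - (Q - 1)) * (Q - 1)).
  under eq_bigr do rewrite -natrX.
  (* The natural subtraction [#|S| - q.-1] truncates when [S] is empty; a nonempty cone has at least
     [q - 1] elements. *)
  rewrite -natr_sum (sum_section_sqr cS); case: (set_0Vmem S) => [S0|[v vS]].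
    by rewrite /s S0 cards0 mul0n mul0r.
  rewrite natrM natrD !natrM qX qp natrB ?qp //.
  rewrite -(card_proportional (cone_neq0 cS vS)).
  apply/subset_leq_card/subsetP => w.
  by rewrite inE; apply: cS.2.
have sum1 : \sum_(l : 'rV[K]_3 | l != 0) 1 = Q ^+ 3 - 1 :> R.
  rewrite -qX -card_rV_neq0 -sum1_card natr_sum; apply: eq_bigl => l.
  by rewrite inE.
have : 0 <= \sum_(l | l != 0) (x l - (Q - 1)) * (s - Q * (Q - 1) - x l).
  apply: sumr_ge0 => l l0; rewrite mulr_ge0 // subr_ge0 ?x_ge //.
  by have := x_le l l0; lra.
have -> : \sum_(l | l != 0) (x l - (Q - 1)) * (s - Q * (Q - 1) - x l)
   = (s - (Q - 1) ^+ 2) * \sum_(l | l != 0) x l - \sum_(l | l != 0) x l ^+ 2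
     - (Q - 1) * (s - Q * (Q - 1)) * \sum_(l : 'rV[K]_3 | l != 0) 1.
  rewrite !mulr_sumr -!sumrB; apply: eq_bigr => l _; ring.
rewrite sumx sumx2 sum1.
(* For a set [B] of points with cone [S], [y] is [(q - 1) (|B| - q - 1)]. *)
set y := s - (Q - 1) * (Q + 1).
have -> : (s - (Q - 1) ^+ 2) * (s * (Q ^+ 2 - 1)) -
  s * ((Q - 1) * (Q ^+ 2 - 1) + (s - (Q - 1)) * (Q - 1)) -
  (Q - 1) * (s - Q * (Q - 1)) * (Q ^+ 3 - 1)
   = (Q * (Q - 1)) * (y ^+ 2 - Q * (Q - 1) ^+ 2) by rewrite /y; ring.
rewrite pmulr_rge0; last by nra.
rewrite subr_ge0 -{1}rr -expr2 -exprMn.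
(* The sign is needed to pass from squares to [y] itself; the two bounds on the section by any
   single line give it. *)
have y0 : 0 <= y.
  pose l := delta_mx 0 0 : 'rV[K]_3.
  have l0 : l != 0.
    by apply/eqP => /matrixP/(_ 0 0)/eqP; rewrite !mxE !eqxx oner_eq0.
  have := x_le l l0; have := x_ge l l0; rewrite /y; nra.
rewrite ler_pXn2r // ?nnegrE ?mulr_ge0 //; last by lra.
rewrite /y -subr_ge0 => h; rewrite -subr_ge0; apply: le_trans h _.
by rewrite le_eqVlt; apply/orP; left; apply/eqP; ring.
Qed.

End BlockingSize.

(** * Incidence between points of the plane and members of the pencil *)

Section Pencil.
Variable K : finFieldType.
Local Notation q := #|K|.

Lemma meval_homog n d (f : {mpoly K[n]}) c (v : 'rV[K]_n) :
  f \is d.-homog -> f.@[(c *: v) 0] = c ^+ d * f.@[v 0].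
Proof.
move=> /dhomogP hf; rewrite !mevalE mulr_sumr !big_seq; apply: eq_bigr => m mf.
rewrite mulrCA; have /= <- := hf m mf; rewrite mdegE -prodrXr -big_split /=.
congr (_ * _).
by apply: eq_bigr => i _; rewrite mxE exprMn.
Qed.

Lemma pspace_point n (v : 'rV[K]_n.+1) : v != 0 ->
  exists P : pspace K n, v \in val P.
Proof.
move=> v0; pose A := [set w in [set w | w != 0] | proportional v w].
have PA : A \in equivalence_partition (@proportional K n.+1) [set w | w != 0].
  by apply/imsetP; exists v; rewrite ?inE.
by exists (Sub A PA); rewrite SubK !inE v0 proportional_refl.
Qed.

(** Any coordinate vector generates its class, so a scaling-invariant property of a point can be
    checked on one of them. *)
Lemma pspace_proportional n (P : pspace K n) v : v \in val P ->
  val P = [set w | proportional v w].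
Proof.
case/imsetP: (valP P) => u _ ->; rewrite !inE => /andP[v0 uv].
apply/setP => w; rewrite !inE.
have [c c0 vE] := proportionalP _ _ uv.
apply/andP/proportionalP => [[w0 /proportionalP[b b0 ->]]|[b b0 ->]].
  exists (b / c); first by rewrite mulf_neq0 ?invr_eq0.
  by rewrite vE scalerA mulfVK.
split; first by rewrite scaler_eq0 negb_or b0.
by apply/proportionalP; exists (b * c); rewrite ?mulf_neq0 // vE scalerA.
Qed.

Definition zero_cone (f : {mpoly K[3]}) : {set 'rV[K]_3} :=
  [set v : 'rV[K]_3 | (v != 0) && (f.@[v 0] == 0)].

Lemma zero_cone_cone d f : f \is d.-homog -> cone (zero_cone f).
Proof.
move=> hf; split=> [|v w]; rewrite !inE ?eqxx // => /andP[v0 /eqP fv] vw.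
rewrite (proportional_neq0 vw) //; case/proportionalP: vw => c _ ->.
by rewrite (meval_homog _ _ hf) fv mulr0 eqxx.
Qed.

Lemma blocking_zero_cone f : blocking_curve f -> blocking_cone (zero_cone f).
Proof.
move=> /forallP bf l l0; have /implyP/(_ l0)/existsP[P /andP[]] := bf l.
case/imsetP: (valP P) => v; rewrite inE => v0 PE.
have vP : v \in val P by rewrite PE !inE v0 proportional_refl.
rewrite !inE => /forallP/(_ v)/implyP/(_ vP) fv.
move=> /forallP/(_ v)/implyP/(_ vP) lv.
by exists v; rewrite ?inE ?v0.
Qed.

Lemma blocking_curveZ (c : K) (f : {mpoly K[3]}) :
  c != 0 -> blocking_curve (c *: f) = blocking_curve f.
Proof.
move=> c0; rewrite /blocking_curve; congr blocking_set.
apply/setP => P; rewrite !inE; apply: eq_forallb => v.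
by rewrite mevalZ mulf_eq0 (negPf c0).
Qed.

Variables (d : nat) (F G : {mpoly K[3]}).
Hypotheses (hF : F \is d.-homog) (hG : G \is d.-homog).
Hypothesis hbase : no_rational_base_point F G.
Implicit Types st : 'rV[K]_2.

Lemma homog_member st : pencil_member F G st \is d.-homog.
Proof. by rewrite rpredD // dhomogZ. Qed.

(** With this vector, a point lies on a member exactly when two vectors of the parameter plane are
    orthogonal. *)
Definition values (v : 'rV[K]_3) : 'rV[K]_2 :=
  \row_i (if i == 0 then F.@[v 0] else G.@[v 0]).

Lemma meval_member st (v : 'rV[K]_3) :
  (pencil_member F G st).@[v 0] = dot st (values v).
Proof.
rewrite mevalD !mevalZ /dot !big_ord_recl big_ord0 !mxE addr0 eqxx /=.
by congr (_ + st 0 _ * _); apply: val_inj.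
Qed.

Lemma values_neq0 v : v != 0 -> values v != 0.
Proof.
move=> v0; apply/eqP => vv; apply: hbase; have [P vP] := pspace_point v0.
have F0 : F.@[v 0] = 0 by move/matrixP/(_ 0 0): vv; rewrite !mxE.
have G0 : G.@[v 0] = 0 by move/matrixP/(_ 0 1): vv; rewrite !mxE.
exists P; rewrite !inE.
split; apply/forallP => w; apply/implyP; rewrite (pspace_proportional vP) inE.
  by case/proportionalP=> c _ ->; rewrite (meval_homog _ _ hF) F0 mulr0.
by case/proportionalP=> c _ ->; rewrite (meval_homog _ _ hG) G0 mulr0.
Qed.

(** Without rational base points [values v] is nonzero, so each of the [q ^ 3 - 1] nonzero [v] lies
    on a single member, which has [q - 1] parameter vectors. *)
Lemma sum_zero_cone :
  (\sum_(st | st != 0%R) #|zero_cone (pencil_member F G st)|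
   = (q ^ 3 - 1) * q.-1)%N.
Proof.
have E st : (#|zero_cone (pencil_member F G st)|
    = \sum_(v : 'rV[K]_3 | v != 0%R) (dot st (values v) == 0%R))%N.
  rewrite -sum1dep_card big_mkcondr; apply: eq_bigr => v _.
  by rewrite meval_member; case: eqP.
under eq_bigr do rewrite E.
rewrite exchange_big -card_rV_neq0 -sum_nat_const /=.
apply: eq_big => [v|v v0]; first by rewrite inE.
have u0 := values_neq0 v0; have := card_orthogonal2 u0 u0.
rewrite proportional_refl expn1 subn1 => <-.
rewrite -sum1dep_card big_mkcondr; apply: eq_bigr => st _.
by rewrite andbb; case: eqP.
Qed.

(** At a common zero, [values v] would be a nonzero vector of the plane orthogonal to two
    independent ones; [card_orthogonal2] counts [q ^ 0 - 1 = 0] of these. *)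
Lemma zero_cone_disjoint st st' v : st != 0 -> st' != 0 ->
  ~~ proportional st st' -> v \in zero_cone (pencil_member F G st) ->
  v \notin zero_cone (pencil_member F G st').
Proof.
move=> s0 s0' nss; rewrite !inE !meval_member => /andP[v0 e1].
rewrite v0; apply/negP => e2.
have := card_orthogonal2 s0 s0'; rewrite (negPf nss) => /eqP.
rewrite cards_eq0 => /eqP/setP/(_ (values v)).
by rewrite !inE values_neq0 // dotC e1 dotC e2.
Qed.

Definition blocking_params :=
  [set st | (st != 0) && blocking_curve (pencil_member F G st)].

(** A nonzero parameter vector outside [blocking_params] lies in the class of a nonblocking member,
    since scaling preserves blocking; each class has [q - 1] vectors. *)
Lemma card_nonblocking :
  (q ^ 2 - 1 <= #|blocking_params| + q.-1 * #|nonblocking_members F G|)%N.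
Proof.
rewrite -card_rV_neq0 -(cardsID blocking_params [set st | st != 0]) leq_add //.
  by rewrite subset_leq_card // subsetIr.
pose P := [set val T | T in nonblocking_members F G].
have <- : #|P| = #|nonblocking_members F G|.
  by rewrite card_imset //; apply: val_inj.
have sub : [set st | st != 0] :\: blocking_params \subset cover P.
  apply/subsetP => st; rewrite !inE => /andP[+ s0]; rewrite s0 /= => nb.
  have [T sT] := pspace_point s0; apply/bigcupP; exists (val T) => //.
  apply: imset_f; rewrite inE; apply/forallP => st'; apply/implyP.
  rewrite (pspace_proportional sT) inE => /proportionalP[c c0 ->].
  by rewrite /pencil_member !mxE -!scalerA -scalerDr blocking_curveZ.
apply: leq_trans (subset_leq_card sub) _.
apply: leq_trans (leq_card_cover P) _; rewrite mulnC -sum_nat_const.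
apply: leq_sum => _ /imsetP[T _ ->].
case/imsetP: (valP T) => st; rewrite inE => s0 TE.
have sT : st \in val T by rewrite TE !inE s0 proportional_refl.
by rewrite (pspace_proportional sT) card_proportional.
Qed.

End Pencil.

Theorem proposition3p2 (R : rcfType) (K : finFieldType) (q : nat)
  (hq : #|K| = q) (d : nat) (F G : {mpoly K[3]})
  (hL : is_pencil d F G) (hbase : no_rational_base_point F G) :
  Num.sqrt (q%:R : R) <= #|nonblocking_members F G|%:R.
Proof.
case: hL => _ hF hG _; rewrite -{}hq.
have q1 : (1 < #|K|)%N := card_finNzRing_gt1 K; pose M := blocking_params F G.
set Q : R := #|K|%:R; set r := Num.sqrt Q.
have Q0 : 0 <= Q by apply: ler0n.
have r0 : 0 <= r by apply: sqrtr_ge0.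
have rr : r * r = Q by rewrite -expr2 sqr_sqrtr.
have Q1 : 1 < Q by rewrite ltr1n.
have qp : #|K|.-1%:R = Q - 1 :> R by rewrite -subn1 natrB // ltnW.
have qX n : (#|K| ^ n - 1)%N%:R = Q ^+ n - 1 :> R.
  by rewrite natrB ?natrX // expn_gt0 ltnW.
have := card_nonblocking F G; rewrite -(ler_nat R) natrD natrM qp qX -/M => kM.
have r1 : 1 <= r by nra.
rewrite -(ler_pM2l (_ : 0 < Q - 1)) ?subr_gt0 //.
(* [M] counts each blocking member [q - 1] times, so this says that at most [q + 1 - sqrt q] members
   are blocking. *)
suff : #|M|%:R <= (Q - 1) * (Q - r + 1) by move: kM; nra.
(* Either there is exactly one blocking member, and [r <= Q] suffices, or every blocking member has
   another one beside it, vacuously so if [M] is empty. *)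
have [/exists_inP[st sM Mst]|/exists_inPn noline] :=
    boolP [exists st in M, M \subset [set st' | proportional st st']].
  have s0 : st != 0 by move: sM; rewrite inE => /andP[].
  have := subset_leq_card Mst.
  rewrite card_proportional // -(ler_nat R) qp => le1.
  have rQ : r <= Q by nra.
  by apply: le_trans le1 _; nra.
have sum_le : (\sum_(st in M) #|zero_cone (pencil_member F G st)|
    <= (#|K| ^ 3 - 1) * #|K|.-1)%N.
  rewrite -(sum_zero_cone hF hG hbase) [leqRHS](bigID (mem M)) /=.
  apply: leq_trans (leq_addr _ _); rewrite leq_eqVlt; apply/orP; left.
  by apply/eqP/eq_bigl => st; rewrite !inE; case: eqP.
have big st : st \in M -> (Q - 1) * (Q + r + 1)
    <= #|zero_cone (pencil_member F G st)|%:R.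
  move=> sM; have := sM; rewrite inE => /andP[s0 bs].
  apply: blocking_cone_card.
  - exact: zero_cone_cone (homog_member hF hG st).
  - exact: blocking_zero_cone.
  (* The other blocking member meets [l] in a point, which cannot lie on the member of [st]. *)
  move=> l l0; have /subsetPn[st'] := noline _ sM; rewrite !inE.
  case/andP=> s0' bs' nss; have [p pZ lp] := blocking_zero_cone bs' l0.
  exists p; split=> //; first by move: pZ; rewrite inE => /andP[].
  apply: (zero_cone_disjoint hF hG hbase s0' s0 _ pZ).
  by apply: contra nss => /proportional_sym.
have : #|M|%:R * ((Q - 1) * (Q + r + 1)) <= (Q ^+ 3 - 1) * (Q - 1).
  apply: le_trans (_ : _ <= ((#|K| ^ 3 - 1) * #|K|.-1)%N%:R) _; last first.
    by rewrite natrM qX qp.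
  rewrite mulr_natl -sumr_const; apply: le_trans (ler_sum _ big) _.
  by rewrite -natr_sum ler_nat.
(* This is [q^2 + q + 1 = (q + r + 1) (q - r + 1)] times [(q - 1)^2]; the product is expanded first
   to expose [r * r], which [ring] alone does not identify with [Q]. *)
have -> : (Q ^+ 3 - 1) * (Q - 1)
    = (Q - 1) * (Q - r + 1) * ((Q - 1) * (Q + r + 1)).
  have -> : (Q - 1) * (Q - r + 1) * ((Q - 1) * (Q + r + 1))
     = (Q - 1) ^+ 2 * ((Q + 1) ^+ 2 - r * r) by ring.
  by rewrite rr; ring.
by rewrite ler_pM2r // mulr_gt0 ?subr_gt0 //; lra.
Qed.
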